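(* Let $X$ be a smooth real algebraic variety and let $W\subset Z\subset X$ be closed subvarieties. Let $f$ be a continuous, hereditarily rational function on $Z$ that is regular on $Z\setminus W$. Then $f$ extends to a continuous, hereditarily rational function $F$ on $X$ that is regular on $X\setminus W$.
   Context: A real algebraic variety is identified with its set of real points, regarded as a Zariski locally closed subset of some $\mathbb{R}^N$ (possibly reducible or singular). Continuity of functions always refers to the Euclidean topology, and functions are real valued. ''Extends'' means $F|_Z=f$ as functions. A function $h$ on a real algebraic variety $X$ is regular at $x\in X$ if one can write $h=p/q$ near $x$ with $p,q$ polynomials and $q(x)\neq 0$; it is regular if it is regular at every point of $X$. A continuous function $h$ on a real algebraic variety $X$ is hereditarily rational if every irreducible real subvariety $V\subset X$ has a Zariski dense open subvariety $V^0\subset V$ such that $h|_{V^0}$ is a regular function on $V^0$. *)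

(* Defs.v *)
From HB Require Import structures.
From mathcomp Require Import all_boot all_order all_algebra.
From mathcomp Require Import all_classical all_reals all_analysis.
(* The notations of mpoly clash with those of MathComp-Analysis. *)
From mathcomp Require Import -(notations) mpoly.

Set Implicit Arguments.
Unset Strict Implicit.
Unset Printing Implicit Defensive.

Import Order.TTheory GRing.Theory Num.Theory.
Import numFieldNormedType.Exports.

Local Open Scope classical_set_scope.
Local Open Scope ring_scope.

(* The Zariski topology on R^N is handled through the predicates below; the
   topology that 'rV[R]_N carries canonically is the Euclidean one. *)
Section RealVarieties.
Context {R : realType} {N : nat}.

Local Notation pt := 'rV[R]_N.
Local Notation pol := (mpoly.mpoly N R).

Definition peval (p : pol) (x : pt) : R := mpoly.meval (fun i => x ord0 i) p.

Definition zariski_closed (A : set pt) : Prop :=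
  exists s : seq pol,
    A = [set x : pt | forall p : pol, p \in s -> peval p x = 0].

Definition zariski_open (U : set pt) : Prop := zariski_closed (~` U).

Definition zariski_closure (A : set pt) : set pt :=
  \bigcap_(C in [set C | zariski_closed C /\ A `<=` C]) C.

(* A real algebraic variety, identified with its set of real points. *)
Definition variety (X : set pt) : Prop :=
  exists C U, [/\ zariski_closed C, zariski_open U & X = C `&` U].

Definition closed_subvariety (X Z : set pt) : Prop :=
  exists2 C, zariski_closed C & Z = X `&` C.

Definition open_subvariety (X U : set pt) : Prop :=
  exists2 O, zariski_open O & U = X `&` O.

Definition zariski_dense (X A : set pt) : Prop := X `<=` zariski_closure A.

Definition irreducible (V : set pt) : Prop :=
  V !=set0 /\
  forall Z1 Z2, closed_subvariety V Z1 -> closed_subvariety V Z2 ->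
    V = Z1 `|` Z2 -> V = Z1 \/ V = Z2.

(* Only the values of h on X matter. "Near x" refers to the Zariski topology;
   with Euclidean neighbourhoods one would also get functions taking different
   constant values on the ovals of an irreducible curve. *)
Definition regular_at (X : set pt) (h : pt -> R) (x : pt) : Prop :=
  exists (p q : pol) (U : set pt),
    [/\ zariski_open U, U x, peval q x != 0 &
        forall y, X y -> U y -> peval q y != 0 /\ h y = peval p y / peval q y].

Definition regular_on (X : set pt) (h : pt -> R) : Prop :=
  forall x, X x -> regular_at X h x.

(* Subvarieties V are locally closed. Continuity is not included here. *)
Definition hereditarily_rational (X : set pt) (h : pt -> R) : Prop :=
  forall V, variety V -> V `<=` X -> irreducible V ->
    exists V0, [/\ open_subvariety V V0, zariski_dense V V0 & regular_on V0 h].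

Definition vanishes_on (X : set pt) (p : pol) : Prop :=
  forall x, X x -> peval p x = 0.

Definition jacobian_at r (g : 'I_r -> pol) (x : pt) : 'M[R]_(r, N) :=
  \matrix_(i, j) peval (mpoly.mderiv j (g i)) x.

(* X is smooth at x: in the local ring of R^N at x, the ideal of X is generated
   by polynomials whose differentials at x are linearly independent. The
   multiplier s expresses the localization. Smooth varieties need not be
   irreducible or equidimensional. *)
Definition smooth_at (X : set pt) (x : pt) : Prop :=
  exists (r : nat) (g : 'I_r -> pol),
    [/\ forall i, vanishes_on X (g i),
        forall p, vanishes_on X p ->
          exists (s : pol) (c : 'I_r -> pol),
            peval s x != 0 /\ s * p = \sum_(i < r) c i * g i
      & row_free (jacobian_at g x)].

Definition smooth (X : set pt) : Prop := forall x, X x -> smooth_at X x.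

End RealVarieties.

(* Main.v *)
Require Import Defs.
From mathcomp Require Import all_boot all_order all_algebra.
From mathcomp Require Import all_classical all_reals all_analysis.
From mathcomp Require Import ring lra.
From mathcomp Require Import -(notations) mpoly.
From mathcomp Require ordered_qelim qe_rcf.
Import Order.TTheory GRing.Theory Num.Theory.
Import numFieldNormedType.Exports.
Set Implicit Arguments.
Unset Strict Implicit.
Unset Printing Implicit Defensive.
Local Open Scope classical_set_scope.
Local Open Scope ring_scope.

(** Write U for the complement of the zero set of a polynomial u with
    X = C & U and C Zariski closed. As X is closed in U, so are Z and W, and it
    suffices to extend f to U. Hereditary rationality of an extension F comes
    for free once F is regular off W: an irreducible V either lies in W, where
    F = f, or meets the regularity locus in a dense open subvariety
    ([hereditarily_rational_extension]). What remains is to find F continuous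
    on U, equal to f on Z, regular off W ([extension_open]).

    Suppose first that f vanishes on W. Real polynomials can be glued by sums
    of squares, so f = P / Q on Z \ W with P, Q polynomials
    ([regular_quotient]). Let z, w >= 0 be polynomials with zero sets Z and W
    in U, and put
      F = P Q w^m / (Q^2 w^m + z).
    The denominator is positive on U \ W, F = P / Q on Z \ W, and F = 0 on W.
    Only continuity at a point a of W is at stake ([flat_extension]). Where
    |P| <= eps |Q| we have |F| <= eps. On the part of a small box around a where
    |P| >= eps |Q|, z is positive as soon as w is, because f is small near a; a
    Lojasiewicz inequality z >= w^k / 2 then gives |F| <= 2 |P Q| w^(m - k),
    which tends to 0 if m = k + 1.

    The exponent k must not depend on a, on the box or on eps. This uniformity
    comes from quantifier elimination: for fixed parameters, a polynomial in
    two variables t, s has constant sign on a horn 0 < t < t0, 0 < s < t^k,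
    where k only depends on its degree in t ([bipoly_sign]). So for every
    semialgebraic family the truth value is constant on such a horn, with k
    uniform in the parameters ([semialgebraic_horn]). It is applied to the
    existence of a point of the box with w = t, |P| >= eps |Q| and z <= s
    ([slab_horn]): by compactness this fails for one t and all small s, hence
    throughout the horn.

    In general, f restricted to W is regular off a strictly smaller closed
    subset W1 ([regular_locus], from hereditary rationality on an irreducible
    open subset of W). By Noetherian induction ([zeros_induction]) it extends to
    some F1, regular off W1; then f - F1 vanishes on W and the first case
    applies to it. *)

(** * Noetherianity of the Zariski topology *)

(** Jump each time to an index minimizing u among all later indices. *)
Lemma nondecreasing_subseq (u : nat -> nat) :
  exists phi : nat -> nat, (forall a, (phi a < phi a.+1)%N) /\
    forall a, (u (phi a) <= u (phi a.+1))%N.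
Proof.
have next a : exists b, (a < b)%N /\ forall c, (a < c)%N -> (u b <= u c)%N.
  have ex : exists v, `[< exists2 b, (a < b)%N & u b = v >].
    by exists (u a.+1); apply/asboolP; exists a.+1.
  case: (ex_minnP ex) => v /asboolP[b ab <-] vmin.
  exists b; split=> // c ac; apply: vmin.
  by apply/asboolP; exists c.
have [g gP] := choice next.
exists (fun k => iter k g (g 0%N)); split => a; first by case: (gP (iter a g (g 0%N))).
set b := iter a g (g 0%N).
have lt_b : (b < iter a.+1 g (g 0%N))%N by have [] := gP b.
have [c [cb ub]] : exists c, (c < b)%N /\ forall d, (c < d)%N -> (u b <= u d)%N.
  by rewrite /b; case: (a) => [|k]; [exists 0%N | exists (iter k g (g 0%N))]; apply: gP.
by apply: ub; apply: ltn_trans lt_b.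
Qed.

Lemma increasing_homo (phi : nat -> nat) (phi_lt : forall a, (phi a < phi a.+1)%N) a b :
  (a < b)%N -> (phi a < phi b)%N.
Proof.
exact: (@homo_ltn _ phi (fun a b => a < b)%N
  (fun _ _ _ => @ltn_trans _ _ _) phi_lt).
Qed.

(** Dickson's lemma: divisibility of monomials is a well quasi-order. Thin out the
    sequence once per variable, making all exponents nondecreasing. *)
Lemma dickson n (m : nat -> multinom n) :
  exists i j, (i < j)%N /\ lem (m i) (m j).
Proof.
have sub (l : seq 'I_n) : exists phi : nat -> nat,
    (forall a, (phi a < phi a.+1)%N) /\
    forall i, i \in l -> forall a b, (a <= b)%N -> (m (phi a) i <= m (phi b) i)%N.
  elim: l => [|c l [phi [phi_lt phi_le]]]; first by exists id.
  have [psi [psi_lt psi_le]] := nondecreasing_subseq (fun a => m (phi a) c).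
  exists (phi \o psi); split => [a|i] /=; first exact: increasing_homo.
  rewrite inE => /predU1P[->|il] a b ab.
    exact: (@homo_leq _ (fun a => m (phi (psi a)) c) leq leqnn
      (fun _ _ _ => @leq_trans _ _ _) psi_le).
  apply: phi_le => //; move: ab; rewrite leq_eqVlt => /predU1P[->//|ab].
  exact/ltnW/increasing_homo.
have [phi [phi_lt phi_le]] := sub (enum 'I_n).
exists (phi 0%N), (phi 1%N); split => //.
by apply/mnm_lepP => i; apply: phi_le; rewrite ?mem_enum.
Qed.

Section Zariski.
Context {R : realType} {N : nat}.
Local Notation pt := 'rV[R]_N.
Local Notation pol := (mpoly.mpoly N R).
Local Notation lc p := (mcoeff (mlead p) p).
Implicit Types (p q : pol) (x y : pt).

Lemma peval0 x : peval 0 x = 0 :> R. Proof. exact: meval0. Qed.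
Lemma peval1 x : peval 1 x = 1 :> R. Proof. exact: meval1. Qed.
Lemma pevalD p q x : peval (p + q) x = peval p x + peval q x.
Proof. exact: mevalD. Qed.
Lemma pevalN p x : peval (- p) x = - peval p x.
Proof. exact: mevalN. Qed.
Lemma pevalM p q x : peval (p * q) x = peval p x * peval q x.
Proof. exact: mevalM. Qed.
Lemma pevalZ c p x : peval (c *: p) x = c * peval p x.
Proof. exact: mevalZ. Qed.
Lemma pevalX p n x : peval (p ^+ n) x = peval p x ^+ n.
Proof. by elim: n => [|n IH]; rewrite ?peval1// !exprS pevalM IH. Qed.
Definition pevalE := (peval0, peval1, pevalD, pevalN, pevalM, pevalZ, pevalX).

Definition zeros (p : pol) : set pt := [set x | peval p x = 0].

(** Hilbert's basis theorem for vanishing ideals, by leading monomials: pick in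
    each I(n+1) \ I(n) an element q n of least leading monomial. If the leading
    monomial of q i divides that of q j with i < j, then cancelling the latter
    by a multiple of q i, which is in I(j), contradicts the choice of q j. *)
Lemma zeros_no_strict_descent (p : nat -> pol) :
  (forall n, zeros (p n.+1) `<=` zeros (p n)) ->
  (forall n, ~ zeros (p n) `<=` zeros (p n.+1)) -> False.
Proof.
move=> dec strict.
pose I n : set pol := [set q | zeros (p n) `<=` zeros q].
have I_homo i j : (i <= j)%N -> I i `<=` I j.
  move=> ij q Iq; apply: subset_trans Iq; 
  apply: (@homo_leq _ (zeros \o p) (fun A B => B `<=` A)) ij => [A|B A C BA CB|k].
  - exact: subset_refl.
  - exact: subset_trans BA.
  - exact: dec.
have lead n : exists q, (I n.+1 q /\ ~ I n q) /\
    forall q', I n.+1 q' -> ~ I n q' -> ~ (mlead q' < mlead q)%O.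
  apply: contrapT => nomin.
  suff all_I q : I n.+1 q -> I n q by apply: (strict n); exact: all_I.
  move: q; apply: mleadrect => q IH Iq; apply: contrapT => Inq; apply: nomin.
  exists q; split => // q' Iq' nIq' lt_q'; apply: nIq'; exact: IH.
have [q qP] := choice lead.
have [i [j [ij le_ij]]] := dickson (fun n => mlead (q n)).
have [[Ij nIj] minj] := qP j; have [[Ii nIi] _] := qP i.
have nz n q' : ~ I n q' -> q' != 0.
  by move=> nI; apply/eqP => q0; apply: nI => x _; rewrite /zeros /= q0 peval0.
have qi0 := nz _ _ nIi; have qj0 := nz _ _ nIj.
pose m := mnm_sub (mlead (q j)) (mlead (q i)).
pose h : pol := (lc (q j) / lc (q i)) *: mpolyX R m.
have h0 : h != 0.
  apply/eqP => /(congr1 (mcoeff m)); rewrite mcoeffZ mcoeffX eqxx mulr1 mcoeff0.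
  by move/eqP; apply/negP; rewrite mulf_neq0 ?invr_eq0 ?mleadc_eq0.
have leadh : mlead (h * q i) = mlead (q j).
  rewrite mleadM// mleadZ ?mleadXm ?submK//.
  by rewrite mulf_neq0 ?invr_eq0 ?mleadc_eq0.
pose r := q j - h * q i.
have rI : I j.+1 r.
  move=> x px; rewrite /zeros /= !pevalE.
  by rewrite (Ij x px) (I_homo _ _ (leqW ij) _ Ii x px) mulr0 subr0.
have rnI : ~ I j r.
  move=> rI'; apply: nIj => x px; have := rI' x px.
  by rewrite /zeros /= !pevalE (I_homo _ _ ij _ Ii x px) mulr0 subr0.
apply: (minj r rI rnI); rewrite lt_neqAle; apply/andP; split; last first.
  by apply: le_trans (mleadB_le _ _) _; rewrite leadh joinxx.
apply/eqP => eq_lead; have /negP := nz _ _ rnI; apply.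
have coefM : mcoeff (mlead (q j)) (q i * mpolyX R m) = lc (q i).
  by have := mcoeffMX (q i) m (mlead (q i)); rewrite submK.
rewrite -mleadc_eq0 eq_lead /r mcoeffB /h -scalerAl mcoeffZ.
by rewrite [mpolyX R m * _]mulrC coefM divfK ?subrr ?mleadc_eq0.
Qed.

Lemma zeros_min (S : set pol) : S !=set0 ->
  exists2 p, S p & forall q, S q -> zeros q `<=` zeros p -> zeros p `<=` zeros q.
Proof.
move=> [p0 Sp0]; apply: contrapT => nomin.
have step (p : {p | S p}) : exists q : {p | S p},
    zeros (sval q) `<=` zeros (sval p) /\ ~ zeros (sval p) `<=` zeros (sval q).
  case: p => p Sp /=; apply: contrapT => nq; apply: nomin; exists p => // q Sq qp.
  apply: contrapT => pq; apply: nq; by exists (exist _ q Sq).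
have [g gP] := choice step.
pose p n := sval (iter n g (exist _ p0 Sp0)).
by apply: (@zeros_no_strict_descent p) => n; have [] := gP (iter n g (exist _ p0 Sp0)).
Qed.

End Zariski.

(** * Semialgebraic conditions are constant on thin horns *)

Module OQ := ordered_qelim.ord.

Section Horn.
Context {R : rcfType}.
Implicit Types (t s : R) (p : {poly {poly R}}).

Definition horn (t0 : R) (k : nat) (t s : R) :=
  [/\ 0 < t, t < t0, 0 < s & s < t ^+ k].

Lemma horn_sub t0 t1 k l t s :
  t1 <= t0 -> t1 <= 1 -> (k <= l)%N -> horn t1 l t s -> horn t0 k t s.
Proof.
move=> t10 t11 kl [t_gt0 t_lt s_gt0 s_lt]; split => //; first exact: lt_le_trans t10.
apply: lt_le_trans s_lt _; apply: ler_wiXn2l => //; first exact: ltW.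
by apply: le_trans t11; exact: ltW.
Qed.

Lemma sgr_dominant (x y : R) : `|y| < `|x| -> Num.sg (x + y) = Num.sg x.
Proof.
move=> yx; case: (ltgtP x 0) => x0.
- move: yx; rewrite (ltr0_norm x0) ltr_norml => /andP[_ yx].
  by rewrite !ltr0_sg//; lra.
- move: yx; rewrite (gtr0_norm x0) ltr_norml => /andP[yx _].
  by rewrite !gtr0_sg//; lra.
- by move: yx; rewrite x0 normr0 normr_lt0.
Qed.

Lemma poly_bounded (q : {poly R}) :
  exists2 M, 0 < M & forall t, 0 <= t <= 1 -> `|q.[t]| <= M.
Proof.
elim/poly_ind: q => [|q c [M M0 qM]].
  by exists 1 => // t _; rewrite horner0 normr0.
exists (M + `|c|) => [|t t01]; first by rewrite ltr_pwDl.
rewrite hornerMXaddC (le_trans (ler_normD _ _))// lerD2r normrM.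
have /andP[t0 t1] := t01; rewrite (ger0_norm t0).
by rewrite -[leRHS]mulr1 ler_pM ?qM.
Qed.

Lemma bipoly_bounded p :
  exists2 M, 0 < M & forall t s, 0 <= t <= 1 -> 0 <= s <= 1 ->
    `|p.[s%:P].[t]| <= M.
Proof.
elim/poly_ind: p => [|p c [M M0 pM]].
  by exists 1 => // t s _ _; rewrite !horner0 normr0.
have [C C0 cC] := poly_bounded c.
exists (M + C) => [|t s t01 s01]; first by rewrite addr_gt0.
rewrite hornerMXaddC hornerD hornerM hornerC.
rewrite (le_trans (ler_normD _ _))// lerD ?cC// normrM.
have /andP[s0 s1] := s01; rewrite (ger0_norm s0).
by rewrite -[leRHS]mulr1 ler_pM ?pM.
Qed.

(** Near 0 a polynomial is equivalent to its lowest term; as this has degree at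
    most d, the lower bound c t^d uses an exponent that depends on the size only. *)
Lemma poly_near0 (q : {poly R}) d : q != 0 -> (size q <= d.+1)%N ->
  exists t0 c (sigma : R), [/\ 0 < t0, 0 < c & forall t, 0 < t -> t < t0 ->
    c * t ^+ d <= `|q.[t]| /\ Num.sg q.[t] = sigma].
Proof.
elim/poly_ind: q d => [d|q c IH d]; first by rewrite eqxx.
have [->|c0 _ _] := eqVneq c 0.
  rewrite addr0 mulf_eq0 polyX_eq0 orbF => q0.
  rewrite size_mulX//; case: d => [|d].
    by rewrite ltnS leqn0 size_poly_eq0 (negPf q0).
  move=> /IH-/(_ q0)[t0 [c' [sigma [t00 c'0 H]]]].
  exists t0, c', sigma; split=> // t tgt0 tlt; have [H1 H2] := H t tgt0 tlt.
  rewrite hornerMX normrM sgrM (gtr0_norm tgt0) (gtr0_sg tgt0) mulr1; split=> //.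
  by rewrite exprSr mulrA ler_pM2r.
have [M M0 qM] := poly_bounded q.
exists (Num.min 1 (`|c| / 2 / M)), (`|c| / 2), (Num.sg c).
have c2 : 0 < `|c| / 2 by rewrite divr_gt0 ?normr_gt0.
split; [by rewrite lt_min ltr01 divr_gt0|exact: c2|move=> t tgt0].
rewrite lt_min => /andP[t1].
rewrite ltr_pdivlMr// => tM; rewrite hornerMXaddC.
have small : `|q.[t] * t| < `|c| / 2.
  rewrite normrM (gtr0_norm tgt0) mulrC; apply: le_lt_trans tM.
  by rewrite ler_pM2l// qM// !ltW.
split; last first.
  rewrite addrC sgr_dominant//; apply: lt_trans small _.
  by rewrite ltr_pdivrMr// mulr_natr mulr2n ltrDl normr_gt0.
have td : `|c| / 2 * t ^+ d <= `|c| / 2.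
  by rewrite ler_piMr ?(ltW c2)// exprn_ile1 ?ltW.
apply: le_trans td _; rewrite addrC; apply: le_trans (lerB_normD _ _).
by rewrite lerBrDr [leRHS]splitr lerD2l ltW.
Qed.

(** The coefficients of p are polynomials in t, and p is a polynomial in s. For
    s < t^d the sign is that of the lowest nonzero coefficient c(t) of p: it is
    at least of order t^(d-1), and the later terms are O(s). *)
Lemma bipoly_sign p d : (forall j, size (p`_j)%R <= d)%N ->
  exists t0 sigma, 0 < t0 /\
    forall t s, horn t0 d t s -> Num.sg p.[s%:P].[t] = sigma.
Proof.
elim/poly_ind: p => [_|p c IH pd].
  by exists 1, 0; split=> // t s _; rewrite !horner0 sgr0.
have [c0|c0] := eqVneq c 0.
  have [|t0 [sigma [t00 H]]] := IH.
    by move=> j; have := pd j.+1; rewrite coefD coefMX coefC /= addr0.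
  exists t0, sigma; split=> // t s h; have := H t s h; case: h => _ _ s0 _.
  by rewrite c0 addr0 hornerMX hornerM hornerC sgrM (gtr0_sg s0) mulr1.
have : (size c <= d)%N by have := pd 0%N; rewrite coefD coefMX coefC /= add0r.
case: d {IH pd} => [|d cd]; first by rewrite leqn0 size_poly_eq0 (negPf c0).
have [t0 [e [sigma [t00 e0 H]]]] := poly_near0 c0 cd.
have [M M0 pM] := bipoly_bounded p.
exists (Num.min (Num.min t0 1) (e / M)), sigma; split.
  by rewrite !lt_min t00 ltr01 divr_gt0.
move=> t s [tgt0]; rewrite !lt_min => /andP[/andP[tt0 t1]].
rewrite ltr_pdivlMr// => tM s0 st; have [H1 H2] := H t tgt0 tt0.
have s1 : s <= 1 by rewrite (le_trans (ltW st))// exprn_ile1 ?ltW.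
rewrite hornerMXaddC hornerD hornerM hornerC addrC sgr_dominant//.
apply: lt_le_trans H1; rewrite normrM (gtr0_norm s0).
apply: (@le_lt_trans _ _ (M * s)).
  by rewrite ler_pM2r// pM ?s1 ?(ltW s0) ?(ltW tgt0) ?(ltW t1).
apply: (@lt_le_trans _ _ (M * t ^+ d.+1)); first by rewrite ltr_pM2l.
by rewrite exprS mulrA ler_pM2r ?exprn_gt0// mulrC ltW.
Qed.

(** The environment in which the variables i and j are the coordinates t and s of
    the horn, while all others are parameters. *)
Definition horn_env (e : seq R) i j t s := set_nth 0 (set_nth 0 e i t) j s.

(** The degree bound d is chosen before the parameters e, hence uniform in them. *)
Lemma term_bipoly (i j : nat) (f : GRing.term R) : GRing.rterm f ->
  exists d, forall e, exists p, (forall k, size (p`_k)%R <= d)%N /\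
    forall t s, GRing.eval (horn_env e i j t s) f = p.[s%:P].[t].
Proof.
have mulT d1 d2 p1 p2 : (forall k, size (p1`_k)%R <= d1)%N ->
    (forall k, size (p2`_k)%R <= d2)%N -> forall k, (size ((p1 * p2)`_k)%R <= d1 + d2)%N.
  move=> h1 h2 k; rewrite coefM (leq_trans (size_sum _ _ _))//.
  apply/bigmax_leqP => l _; apply: leq_trans (size_polyMleq _ _) _.
  by apply: leq_trans (leq_pred _) _; rewrite leq_add.
have constT c : exists p, (forall k, size (p`_k)%R <= 1)%N /\
    forall t s, c = p.[s%:P].[t].
  exists c%:P%:P; split=> [k|t s]; last by rewrite !hornerC.
  by rewrite coefC; case: eqP; rewrite ?size_poly0// size_polyC; case: eqP.
elim: f => //=.
- move=> n _; exists 2%N => e; rewrite /horn_env.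
  have [nj|nj] := eqVneq n j.
    exists 'X; split=> [k|t s]; last by rewrite hornerX hornerC nth_set_nth /= nj eqxx.
    by rewrite coefX; case: eqP; rewrite ?size_poly0 ?size_poly1.
  have [ni|ni] := eqVneq n i.
    exists ('X)%:P; split=> [k|t s].
      by rewrite coefC; case: eqP; rewrite ?size_poly0 ?size_polyX.
    by rewrite hornerC hornerX !nth_set_nth /= (negPf nj) nth_set_nth /= ni eqxx.
  have [p [ps pE]] := constT e`_n; exists p; split=> [k|t s].
    exact: leq_trans (ps k) _.
  by rewrite nth_set_nth /= (negPf nj) nth_set_nth /= (negPf ni).
- by move=> c _; exists 1%N => e; exact: constT.
- by move=> c _; exists 1%N => e; exact: constT.
- move=> f1 IH1 f2 IH2 /andP[/IH1[d1 H1] /IH2[d2 H2]].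
  exists (maxn d1 d2) => e; have [p1 [s1 E1]] := H1 e; have [p2 [s2 E2]] := H2 e.
  exists (p1 + p2); split=> [k|t s]; last by rewrite E1 E2 !hornerD.
  by rewrite coefD (leq_trans (size_polyD _ _))// geq_max !leq_max s1 s2 orbT.
- move=> f1 IH1 /IH1[d1 H1]; exists d1 => e; have [p1 [s1 E1]] := H1 e.
  by exists (- p1); split=> [k|t s]; [rewrite coefN size_polyN|rewrite E1 !hornerN].
- move=> f1 IH1 n /IH1[d1 H1]; exists d1 => e; have [p1 [s1 E1]] := H1 e.
  exists (p1 *+ n); split=> [k|t s]; last by rewrite E1 !hornerMn.
  by rewrite coefMn -scaler_nat (leq_trans (size_scale_leq _ _)).
- move=> f1 IH1 f2 IH2 /andP[/IH1[d1 H1] /IH2[d2 H2]].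
  exists (d1 + d2)%N => e; have [p1 [s1 E1]] := H1 e; have [p2 [s2 E2]] := H2 e.
  by exists (p1 * p2); split=> [|t s]; [exact: mulT|rewrite E1 E2 !hornerM].
- move=> f1 IH1 n /IH1[d1 H1].
  exists (n * d1 + 1)%N => e; have [p1 [s1 E1]] := H1 e.
  exists (p1 ^+ n); split=> [|t s]; last by rewrite E1 !horner_exp.
  elim: n => [k|n IHn]; last by rewrite mulSn -addnA exprS; exact: mulT.
  by rewrite expr0 coef1; case: eqP; rewrite ?size_poly0 ?size_poly1.
Qed.

Lemma term_sign (i j : nat) (f : GRing.term R) : GRing.rterm f ->
  exists d, forall e, exists t0 sigma, 0 < t0 /\ forall t s, horn t0 d t s ->
    Num.sg (GRing.eval (horn_env e i j t s) f) = sigma.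
Proof.
move=> /(term_bipoly i j)[d H]; exists d => e; have [p [pd pE]] := H e.
have [t0 [sigma [t00 ps]]] := bipoly_sign pd.
by exists t0, sigma; split=> // t s h; rewrite pE ps.
Qed.

Definition horn_const i j (A : seq R -> bool) := exists k, forall e,
  exists t0 b, 0 < t0 /\ forall t s, horn t0 k t s -> A (horn_env e i j t s) = b.

Lemma horn_const_op i j (A B : seq R -> bool) (c : bool -> bool -> bool) :
  horn_const i j A -> horn_const i j B -> horn_const i j (fun e => c (A e) (B e)).
Proof.
move=> [k Ak] [l Bl]; exists (maxn k l) => e.
have [ta [a [ta0 Aa]]] := Ak e; have [tb [b [tb0 Bb]]] := Bl e.
exists (Num.min 1 (Num.min ta tb)), (c a b); rewrite !lt_min ltr01 ta0 tb0.
split=> // t s h; rewrite (Aa t s) ?(Bb t s)//;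
  apply: horn_sub h; by rewrite ?leq_maxl ?leq_maxr ?ge_min ?lexx ?orbT.
Qed.

Lemma horn_const_qf i j (f : OQ.formula R) :
  OQ.qf_form f && OQ.rformula f -> horn_const i j (fun e => OQ.qf_eval e f).
Proof.
have sgT (c : R -> bool) f1 f2 : GRing.rterm f1 && GRing.rterm f2 ->
    horn_const i j
      (fun e => c (Num.sg (GRing.eval e f1 - GRing.eval e f2))).
  move=> r12; have [|d H] := @term_sign i j (GRing.Add f1 (GRing.Opp f2)).
    exact: r12.
  exists d => e; have [t0 [sigma [t00 Hs]]] := H e.
  by exists t0, (c sigma); split=> // t s /Hs <-.
have ext (A B : seq R -> bool) : A =1 B -> horn_const i j A -> horn_const i j B.
  move=> AB [k H]; exists k => e; have [t0 [b [t00 Hb]]] := H e.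
  by exists t0, b; split=> // t s /Hb; rewrite AB.
elim: f => //=.
- by move=> b _; exists 0%N => e; exists 1, b.
- move=> f1 f2 r; apply: ext (sgT (fun x => x == 0) f1 f2 r) => e.
  by rewrite sgr_eq0 subr_eq0.
- move=> f1 f2 r; apply: ext (sgT (fun x => x < 0) f1 f2 r) => e.
  by rewrite sgr_lt0 subr_lt0.
- move=> f1 f2 r; apply: ext (sgT (fun x => x <= 0) f1 f2 r) => e.
  by rewrite sgr_le0 subr_le0.
- by move=> f1 IH1 f2 IH2 /andP[/andP[q1 q2] /andP[r1 r2]];
    apply: (@horn_const_op i j _ _ andb); [apply: IH1|apply: IH2]; apply/andP.
- by move=> f1 IH1 f2 IH2 /andP[/andP[q1 q2] /andP[r1 r2]];
    apply: (@horn_const_op i j _ _ orb); [apply: IH1|apply: IH2]; apply/andP.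
- by move=> f1 IH1 f2 IH2 /andP[/andP[q1 q2] /andP[r1 r2]];
    apply: (@horn_const_op i j _ _ implb); [apply: IH1|apply: IH2]; apply/andP.
- by move=> f1 IH1 /IH1 H1; apply: (horn_const_op (fun a _ => ~~ a) H1 H1).
Qed.

Definition semialgebraic (A : seq R -> Prop) :=
  exists f, forall e, A e <-> OQ.holds e f.

(** Uniform Lojasiewicz principle: the exponent k of the horn is the same for all
    values of the parameters; only its length t0 depends on them. Quantifier
    elimination reduces this to the signs of finitely many terms. *)
Lemma semialgebraic_horn i j A : semialgebraic A ->
  exists k, forall e, exists t0 (b : bool), 0 < t0 /\
    forall t s, horn t0 k t s -> (A (horn_env e i j t s) <-> b).
Proof.
move=> [f Af].
have qf := OQ.quantifier_elim_wf (@qe_rcf.wf_QE_wproj R) (OQ.to_rform_rformula f).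
have [k H] := horn_const_qf i j qf; exists k => e.
have [t0 [b [t00 Hb]]] := H e; exists t0, b; split=> // t s /Hb <-; rewrite Af.
exact: rwP (qe_rcf.rcf_satP _ _).
Qed.

End Horn.

(** * A uniform Lojasiewicz inequality *)

Section Semialgebraic.
Context {R : rcfType}.
Implicit Types (e : seq R) (g h : seq R -> R) (A B : seq R -> Prop).

Definition polyfun g := exists f, forall e, GRing.eval e f = g e.

Lemma polyfun_const (c : R) : polyfun (fun=> c).
Proof. by exists (GRing.Const c). Qed.

Lemma polyfun_var i : polyfun (fun e => e`_i).
Proof. by exists (GRing.Var _ i). Qed.

Lemma polyfunD g h : polyfun g -> polyfun h -> polyfun (fun e => g e + h e).
Proof. by move=> [f1 E1] [f2 E2]; exists (GRing.Add f1 f2) => e /=; rewrite E1 E2. Qed.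

Lemma polyfunN g : polyfun g -> polyfun (fun e => - g e).
Proof. by move=> [f1 E1]; exists (GRing.Opp f1) => e /=; rewrite E1. Qed.

Lemma polyfunM g h : polyfun g -> polyfun h -> polyfun (fun e => g e * h e).
Proof. by move=> [f1 E1] [f2 E2]; exists (GRing.Mul f1 f2) => e /=; rewrite E1 E2. Qed.

Lemma polyfunX g n : polyfun g -> polyfun (fun e => g e ^+ n).
Proof. by move=> [f1 E1]; exists (GRing.Exp f1 n) => e /=; rewrite E1. Qed.

Lemma polyfun_ext g h : g =1 h -> polyfun g -> polyfun h.
Proof. by move=> gh [f E]; exists f => e; rewrite E gh. Qed.

Lemma polyfun_meval N (p : mpoly N R) k :
  polyfun (fun e => meval (fun i : 'I_N => e`_(k + i)) p).
Proof.
have prodP (m : multinom N) (l : seq 'I_N) :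
    polyfun (fun e => \prod_(i <- l) e`_(k + i) ^+ m i).
  elim: l => [|i l IH].
    by apply: polyfun_ext (polyfun_const 1) => e; rewrite big_nil.
  apply: polyfun_ext (polyfunM (polyfunX (m i) (polyfun_var (k + i))) IH) => e.
  by rewrite big_cons.
have sumP (l : seq (multinom N)) : polyfun (fun e =>
    \sum_(m <- l) mcoeff m p * \prod_(i < N) e`_(k + i) ^+ m i).
  elim: l => [|m l IH].
    by apply: polyfun_ext (polyfun_const 0) => e; rewrite big_nil.
  apply: polyfun_ext (polyfunD (polyfunM (polyfun_const (mcoeff m p))
    (prodP m (index_enum 'I_N))) IH) => e.
  by rewrite big_cons.
by apply: polyfun_ext (sumP (msupp p)) => e; rewrite mevalE.
Qed.

Lemma semialg_ext A B : (forall e, A e <-> B e) -> semialgebraic A -> semialgebraic B.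
Proof. by move=> AB [f E]; exists f => e; rewrite -AB. Qed.

Lemma semialg_le g h : polyfun g -> polyfun h -> semialgebraic (fun e => g e <= h e).
Proof. by move=> [f1 E1] [f2 E2]; exists (OQ.Le f1 f2) => e /=; rewrite E1 E2. Qed.

Lemma semialg_eq g h : polyfun g -> polyfun h -> semialgebraic (fun e => g e = h e).
Proof. by move=> [f1 E1] [f2 E2]; exists (OQ.Equal f1 f2) => e /=; rewrite E1 E2. Qed.

Lemma semialg_and A B : semialgebraic A -> semialgebraic B ->
  semialgebraic (fun e => A e /\ B e).
Proof. by move=> [f1 E1] [f2 E2]; exists (OQ.And f1 f2) => e /=; rewrite E1 E2. Qed.

Lemma semialg_all (I : eqType) (l : seq I) (A : I -> seq R -> Prop) :
  (forall i, semialgebraic (A i)) -> semialgebraic (fun e => forall i, i \in l -> A i e).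
Proof.
move=> sA; elim: l => [|i l IH]; first by exists (OQ.Bool true) => e; split.
apply: semialg_ext (semialg_and (sA i) IH) => e; split=> [[Ai Al] j|AA].
  by rewrite inE => /predU1P[->|/Al].
by split=> [|j jl]; apply: AA; rewrite inE ?eqxx ?jl ?orbT.
Qed.

(** A block of quantifiers is expressed by agreement of the environments off l, so
    that no iterated updates appear in its uses. *)
Lemma semialg_exists (l : seq nat) A : semialgebraic A ->
  semialgebraic (fun e => exists e', (forall i, i \notin l -> e'`_i = e`_i) /\ A e').
Proof.
move=> [f E]; exists (foldr OQ.Exists f l) => e.
have -> : (exists e', (forall i, i \notin l -> e'`_i = e`_i) /\ A e') <->
    (exists e', (forall i, i \notin l -> e'`_i = e`_i) /\ OQ.holds e' f).
  by split=> -[e' [ee' Ae']]; exists e'; split=> //; apply/E.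
elim: l e => [|i l IH] e /=.
  split=> [[e' [ee']]|fe]; last by exists e.
  by apply: OQ.eq_holds => j; rewrite ee'.
split=> [[e' [ee' fe']]|[x /IH[e' [ee' fe']]]].
  exists e'`_i; apply/IH; exists e'; split=> // j jl; rewrite nth_set_nth /=.
  by case: eqP => [->//|ji]; apply: ee'; rewrite inE negb_or jl andbT; apply/eqP.
exists e'; split=> // j; rewrite inE negb_or => /andP[ji jl].
by rewrite ee'// nth_set_nth /= (negPf ji).
Qed.

End Semialgebraic.

Section UniformLojasiewicz.
Context {R : realType} {N : nat}.
Implicit Types (w z A B : mpoly N R) (a x : 'rV[R]_N).

(** The points of a box around a that lie on the level w = t and outside the region
    where B / A is small, and at which z is at most s: the competitors for small
    values of z. *)
Definition slab w z A B (a : 'rV[R]_N) (r eps t s : R) (x : 'rV[R]_N) :=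
  [/\ forall i, - r <= x ord0 i - a ord0 i <= r, peval w x = t,
      eps * peval A x <= peval B x & peval z x <= s].

(** The parameters r, eps, t, s are the variables 0 to 3 and the centre occupies the
    next N ones; the quantified point x uses the N variables after these. *)
Lemma slab_semialgebraic w z A B : semialgebraic (fun e : seq R =>
  exists x, slab w z A B (\row_i e`_(4 + i)) e`_0 e`_1 e`_2 e`_3 x).
Proof.
pose X (e : seq R) := fun i : 'I_N => e`_(4 + N + i).
have mv p (e : seq R) : meval (X e) p = peval p (\row_i X e i).
  by apply: meval_eq => i; rewrite mxE.
pose A0 (e : seq R) := (forall i : 'I_N, i \in enum 'I_N ->
    - e`_0 <= X e i - e`_(4 + i) /\ X e i - e`_(4 + i) <= e`_0) /\
  (meval (X e) w = e`_2 /\ (e`_1 * meval (X e) A <= meval (X e) B /\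
   meval (X e) z <= e`_3)).
have A0P : semialgebraic A0.
  apply: semialg_and.
    apply: semialg_all => i; apply: semialg_and; apply: semialg_le;
      do ?[apply: polyfunD|apply: polyfunN]; exact: polyfun_var.
  apply: semialg_and; [|apply: semialg_and].
  - by apply: semialg_eq; [exact: polyfun_meval|exact: polyfun_var].
  - apply: semialg_le; last exact: polyfun_meval.
    by apply: polyfunM; [exact: polyfun_var|exact: polyfun_meval].
  - by apply: semialg_le; [exact: polyfun_meval|exact: polyfun_var].
apply: semialg_ext (semialg_exists (iota (4 + N) N) A0P) => e; split.
  move=> [e' [ee' [box [we [Be ze]]]]].
  have ee i : (i < 4 + N)%N -> e'`_i = e`_i.
    by move=> i4; apply: ee'; rewrite mem_iota negb_and -ltnNge i4.
  exists (\row_i X e' i); split; rewrite -?mv -?ee// => i.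
  by rewrite !mxE -ee ?ltn_add2l//; apply/andP/box; rewrite mem_enum.
move=> [x [box wx Bx zx]].
pose e' := mkseq (fun j => if insub (j - (4 + N))%N is Some i then
   (if (4 + N <= j)%N then x ord0 i else e`_j) else e`_j)
   (maxn (size e) (4 + N + N)).
have e'X (i : 'I_N) : X e' i = x ord0 i.
  rewrite /X nth_mkseq ?leq_max ?ltn_add2l ?ltn_ord ?orbT//.
  by rewrite addKn leq_addr valK.
have ee' i : i \notin iota (4 + N) N -> e'`_i = e`_i.
  rewrite mem_iota negb_and -ltnNge -leqNgt => iN.
  have [imax|imax] := ltnP i (maxn (size e) (4 + N + N)); last first.
    rewrite !nth_default ?size_mkseq//; apply: leq_trans imax; exact: leq_maxl.
  rewrite nth_mkseq//; case: insubP => // j jN _; case: leqP => // Ni.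
  by move: iN jN; rewrite ltnNge Ni /= ltn_subLR// => Ni'; rewrite ltnNge Ni'.
have xE : \row_i X e' i = x by apply/rowP => i; rewrite mxE e'X.
have ee i : (i < 4 + N)%N -> e'`_i = e`_i.
  by move=> i4; apply: ee'; rewrite mem_iota negb_and -ltnNge i4.
exists e'; split=> //; rewrite /A0 !mv xE !ee//; split=> // i _.
by rewrite e'X ee ?ltn_add2l//; apply/andP; have := box i; rewrite mxE.
Qed.

Lemma slab_horn w z A B : exists k, forall a (r eps : R), exists t0 (b : bool),
  0 < t0 /\ forall t s, horn t0 k t s ->
    ((exists x, slab w z A B a r eps t s x) <-> b).
Proof.
have [k H] := semialgebraic_horn 2 3 (slab_semialgebraic w z A B).
exists k => a r eps.
have [t0 [b [t00 Hb]]] := H [:: r, eps, 0, 0 & [seq a ord0 i | i <- enum 'I_N]].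
exists t0, b; split=> // t s /Hb <-; rewrite /horn_env /=.
suff -> : \row_i [:: r, eps, t, s & [seq a ord0 i | i <- enum 'I_N]]`_(4 + i) = a.
  by [].
apply/rowP => i; rewrite mxE /= add0n (nth_map i) ?size_enum_ord ?ltn_ord//.
by rewrite nth_ord_enum.
Qed.

End UniformLojasiewicz.

(** * Extension of a function that vanishes on W *)

Section Flat.
Context {R : realType} {N : nat}.
Local Notation pt := 'rV[R]_N.
Local Notation pol := (mpoly.mpoly N R).
Implicit Types (z w P Q p q : pol) (x a : pt).

Lemma peval_continuous p : continuous (peval p : pt -> R).
Proof.
elim/mpolyind: p => [|c m p _ _ IH] x.
  rewrite (_ : peval 0 = fun=> 0); first exact: cst_continuous.
  by apply/funext => y; rewrite peval0.
rewrite (_ : peval _ = fun y => c * peval (mpolyX R m) y + peval p y); last first.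
  by apply/funext => y; rewrite !pevalE.
apply: (@continuousD _ _ _ (fun y : pt => c * peval (mpolyX R m) y)); last exact: IH.
apply: (@continuousM _ _ (fun=> c)); first exact: cst_continuous.
rewrite (_ : peval _ = fun y : pt => \prod_(i < N) y ord0 i ^+ m i); last first.
  by apply/funext => y; rewrite /peval mevalX.
elim: (index_enum _) => [|i l IHl].
  rewrite (_ : (fun _ => _) = fun=> 1); first exact: cst_continuous.
  by apply/funext => y; rewrite big_nil.
rewrite (_ : (fun _ => _) = fun y : pt =>
    y ord0 i ^+ m i * \prod_(j <- l) y ord0 j ^+ m j).
  apply: (@continuousM _ _ (fun y : pt => y ord0 i ^+ m i)); last exact: IHl.
  apply: (@continuous_comp _ _ _ (fun y : pt => y ord0 i) (fun u : R => u ^+ m i)).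
    exact: coord_continuous.
  exact: exprn_continuous.
by apply/funext => y; rewrite big_cons.
Qed.

Definition box a (r : R) : set pt :=
  [set x | forall i, - r <= x ord0 i - a ord0 i <= r].

Lemma box_compact a r : compact (box a r).
Proof.
rewrite (_ : box a r = [set x | forall i,
    `[a ord0 i - r, a ord0 i + r]%classic (x ord0 i)]).
  apply: (@rV_compact _ _ (fun i => `[a ord0 i - r, a ord0 i + r]%classic)) => i.
  exact: segment_compact.
apply/seteqP; split=> x bx i; have := bx i; rewrite /= in_itv /=.
  by move=> /andP[? ?]; apply/andP; split; lra.
by move=> /andP[? ?]; apply/andP; split; lra.
Qed.

Lemma nbhs_box a r : 0 < r -> nbhs a (box a r).
Proof.
move=> r0; apply/nbhs_ballP; exists r => // x [_ ax] i.
have := ax ord0 i; rewrite /ball /= distrC ltr_norml => /andP[? ?].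
by rewrite !ltW.
Qed.

Lemma nbhs_boxP a (V : set pt) : nbhs a V -> exists2 r, 0 < r & box a r `<=` V.
Proof.
move=> /nbhs_ballP[r /= r0 rV]; exists (r / 2); first by rewrite divr_gt0.
move=> x bx; apply: rV; split=> // i j; rewrite (ord1 i) /ball /= distrC.
by have /andP[? ?] := bx j; rewrite ltr_norml; apply/andP; split; lra.
Qed.

Lemma compact_min_gt0 (K : set pt) z : compact K ->
  (forall x, K x -> 0 < peval z x) -> exists2 s, 0 < s & forall x, K x -> s < peval z x.
Proof.
move=> Kc zK; have [->|/set0P K0] := eqVneq K set0; first by exists 1.
have [|c cK cmin] := EVT_min_rV K0 Kc (f := peval z).
  exact/continuous_subspaceT/peval_continuous.
exists (peval z c / 2); first by rewrite divr_gt0// zK// -inE.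
move=> x Kx; apply: lt_le_trans (cmin x _); last by rewrite inE.
by rewrite ltr_pdivrMr// mulr_natr mulr2n ltrDl zK// -inE.
Qed.

(** The extension is P Q w^m / (Q^2 w^m + z) with m = k + 1, k being the uniform
    exponent of [slab_horn] for A = Q^2, B = P^2. It is dominated by |P / Q| where
    this is small, and by 2 |P Q| w elsewhere. *)
Lemma flat_extension (U : set pt) z w P Q (f : pt -> R) : open U ->
  (forall x, 0 <= peval z x) -> (forall x, 0 <= peval w x) ->
  {within U `&` zeros z, continuous f} ->
  (forall x, U x -> peval w x = 0 -> peval z x = 0 /\ f x = 0) ->
  (forall x, U x -> peval z x = 0 -> peval w x != 0 ->
    peval Q x != 0 /\ f x = peval P x / peval Q x) ->
  exists p q : pol, let F x := peval p x / peval q x in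
  [/\ forall x, U x -> peval z x = 0 -> F x = f x,
      forall x, U x -> {for x, continuous F} &
      forall x, U x -> peval w x != 0 -> peval q x != 0].
Proof.
move=> Uo z0 w0 fc fW fZ.
have [k slabP] := slab_horn w z (Q ^+ 2) (P ^+ 2).
pose p := P * Q * w ^+ k.+1; pose q := Q ^+ 2 * w ^+ k.+1 + z.
have q0 x : U x -> peval w x != 0 -> peval q x != 0.
  move=> Ux wx; have wgt0 : 0 < peval w x by rewrite lt_def wx w0.
  rewrite /q !pevalE; have [zx|zx] := eqVneq (peval z x) 0.
    have [Qx _] := fZ x Ux zx wx.
    by rewrite zx addr0 mulf_neq0// expf_neq0.
  have zgt0 : 0 < peval z x by rewrite lt_def zx z0.
  by rewrite gt_eqF// ltr_wpDl// mulr_ge0 ?sqr_ge0 ?exprn_ge0.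
(* The convention 0 / 0 = 0 gives the right value on W, whence k.+1 > 0. *)
exists p, q => F.
have FW x : peval w x = 0 -> F x = 0.
  by move=> wx; rewrite /F /p !pevalE wx expr0n mulr0 mul0r.
split=> // [x Ux zx|a Ua].
  have [wx|wx] := eqVneq (peval w x) 0.
    by have [_ ->] := fW x Ux wx; exact: FW.
  have [Qx ->] := fZ x Ux zx wx.
  rewrite /F /p /q !pevalE zx addr0.
  have wk : peval w x ^+ k.+1 != 0 by rewrite expf_neq0.
  by move: (_ ^+ k.+1) wk => v v0; field; rewrite v0 Qx.
have [wa|wa] := eqVneq (peval w a) 0; last first.
  apply: (@continuousM _ _ (peval p)); first exact: peval_continuous.
  by apply: continuousV; [exact: q0|exact: peval_continuous].
have [za fa] := fW a Ua wa.
suff : F x @[x --> a] --> (0 : R) by rewrite -(FW a wa).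
apply/(@cvgrPdist_lt _ _ _ (nbhs a) _ F 0) => eta eta0.
pose h := eta / 2; have h0 : 0 < h by rewrite divr_gt0.
have [r r0 rU] : exists2 r, 0 < r & forall x, box a r x ->
    U x /\ (peval z x = 0 -> `|f x| < h).
  apply: nbhs_boxP; apply: filterI; first exact: open_nbhs_nbhs.
  have /subspace_continuousP /(_ a (conj Ua za)) := fc.
  rewrite /from_subspace fa => /cvgrPdist_lt /(_ h h0); rewrite /prop_near1 /within /=.
  have : nbhs a U by exact: open_nbhs_nbhs.
  apply: filterS2 => x Ux H zx; have := H (conj Ux zx).
  by rewrite sub0r normrN.
have [t0 [b [t00 Hb]]] := slabP a r (h ^+ 2).
(* It suffices to refute the existence of slab points at one (t, s) in the horn. *)
have bF : b = false.
  pose t1 := t0 / 2; have t1P : 0 < t1 < t0.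
    by rewrite divr_gt0//= ltr_pdivrMr// mulr_natr mulr2n ltrDl.
  have /andP[t1gt0 t1lt] := t1P.
  pose K := box a r `&` ([set x | peval w x = t1] `&`
    [set x | h ^+ 2 * peval (Q ^+ 2) x <= peval (P ^+ 2) x]).
  have Kc : compact K.
    apply: compact_closedI; first exact: box_compact.
    apply: closedI.
      rewrite (_ : mkset _ = peval w @^-1` [set t1])//.
      by apply: closed_comp; [move=> x _; exact: peval_continuous|exact: closed_eq].
    rewrite (_ : mkset _ = peval (P ^+ 2 - h ^+ 2 *: Q ^+ 2) @^-1` [set y | 0 <= y]).
      by apply: closed_comp; [move=> x _; exact: peval_continuous|exact: closed_ge].
    by apply/seteqP; split=> x /=; rewrite !pevalE subr_ge0.
  have [|s s0 sK] := compact_min_gt0 Kc (z := z).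
    move=> x [bx [wx]] /=; rewrite !pevalE => PQ.
    have [Ux fx] := rU x bx; rewrite lt_def z0 andbT; apply/eqP => zx.
    have wx0 : peval w x != 0 by rewrite wx gt_eqF.
    have [Qx fE] := fZ x Ux zx wx0; move: (fx zx); rewrite fE normrM normfV.
    rewrite ltr_pdivrMr ?normr_gt0// ltNge => /negP; apply.
    rewrite -(@ler_pXn2r _ 2)// ?nnegrE ?(mulr_ge0 (ltW h0))//.
    by rewrite exprMn !real_normK ?num_real.
  pose s1 := Num.min s (t1 ^+ k / 2).
  have /Hb : horn t0 k t1 s1.
    have t1k : 0 < t1 ^+ k by rewrite exprn_gt0.
    split; rewrite ?lt_min ?s0 ?divr_gt0//.
    by rewrite gt_min [X in _ || X]ltr_pdivrMr// mulr_natr mulr2n ltrDl t1k orbT.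
  case: (b) => // -[_ /(_ isT)[x [bx wx PQ]]].
  by rewrite le_min => /andP[zs _]; have := sK x (conj bx (conj wx PQ)); rewrite ltNge zs.
have near_w : \forall x \near a, peval w x < t0.
  have := @peval_continuous w a; rewrite /continuous_at wa.
  move=> /cvgrPdist_lt /(_ t0 t00); apply: filterS => x.
  by rewrite sub0r normrN ger0_norm.
have near_p : \forall x \near a, `|2 * peval (P * Q * w) x| < eta.
  have := @peval_continuous (P * Q * w) a; rewrite /continuous_at.
  rewrite (pevalM (P * Q) w a) wa mulr0 => /cvgrPdist_lt /(_ h h0); apply: filterS => x.
  rewrite sub0r normrN normrM ger0_norm// => ?.
  by rewrite -ltr_pdivlMl// [ltRHS]mulrC.
near=> x.
have bx : box a r x by near: x; exact: nbhs_box.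
have [Ux fx] := rU x bx.
have wt : peval w x < t0 by near: x.
have pe : `|2 * peval (P * Q * w) x| < eta by near: x.
rewrite sub0r normrN; have [wx|wx] := eqVneq (peval w x) 0.
  by rewrite FW// normr0.
have wgt0 : 0 < peval w x by rewrite lt_def wx w0.
have wk0 : 0 < peval w x ^+ k.+1 by rewrite exprn_gt0.
have qgt0 : 0 < peval q x.
  rewrite lt_def q0//= /q !pevalE.
  by rewrite addr_ge0 ?z0// mulr_ge0 ?sqr_ge0// ltW.
rewrite /F normrM normfV (gtr0_norm qgt0) ltr_pdivrMr//.
(* Off the region where P / Q is small, z > w^k / 2 bounds F by 2 |P Q| w. *)
have [PQ|PQ] := lerP (h ^+ 2 * peval (Q ^+ 2) x) (peval (P ^+ 2) x).
  pose s := peval w x ^+ k / 2.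
  have wkk : 0 < peval w x ^+ k by rewrite exprn_gt0.
  have /Hb : horn t0 k (peval w x) s.
    split=> //; first by rewrite divr_gt0.
    by rewrite ltr_pdivrMr// mulr_natr mulr2n ltrDl.
  rewrite bF => -[noslab _].
  have zs : s < peval z x.
    by rewrite ltNge; apply/negP => zs; suff: false by []; apply: noslab; exists x.
  apply: (@le_lt_trans _ _ (`|2 * peval (P * Q * w) x| * s)).
    rewrite /p /s !pevalE exprSr.
    rewrite !normrM (ger0_norm (ltW wgt0)) (ger0_norm (ltW wkk)) (ger0_norm (ler0n R 2)).
    by rewrite le_eqVlt; apply/orP; left; apply/eqP; field.
  apply: (@lt_le_trans _ _ (eta * s)).
    by rewrite ltr_pM2r// divr_gt0.
  rewrite ler_pM2l// /q !pevalE; apply: le_trans (ltW zs) _.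
  by rewrite lerDr mulr_ge0 ?sqr_ge0// ltW.
rewrite !pevalE in PQ.
have PhQ : `|peval P x| <= h * `|peval Q x|.
  rewrite -(@ler_pXn2r _ 2)// ?nnegrE ?(mulr_ge0 (ltW h0))//.
  rewrite exprMn !real_normK ?num_real//; exact: ltW.
apply: (@le_lt_trans _ _ (h * peval q x)); last first.
  by rewrite ltr_pM2r// /h ltr_pdivrMr// mulr_natr mulr2n ltrDl.
rewrite /p /q !pevalE !normrM (ger0_norm (ltW wk0)).
apply: (@le_trans _ _ (h * (peval Q x ^+ 2 * peval w x ^+ k.+1))).
  rewrite mulrA ler_pM2r// -(real_normK (num_real (peval Q x))) expr2 mulrA.
  by rewrite ler_wpM2r.
by rewrite ler_pM2l// lerDl z0.
Unshelve. all: by end_near.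
Qed.

End Flat.

(** * Zariski closed sets and regular functions *)

Section Geometry.
Context {R : realType} {N : nat}.
Local Notation pt := 'rV[R]_N.
Local Notation pol := (mpoly.mpoly N R).
Implicit Types (p q c z : pol) (x : pt) (f g h : pt -> R) (A W Y : set pt).

Lemma zeros_induction (P : pol -> Prop) :
  (forall p, (forall q, zeros q `<=` zeros p -> ~ zeros p `<=` zeros q -> P q) -> P p) ->
  forall p, P p.
Proof.
move=> step p; apply: contrapT => nPp.
have [|q nPq qmin] := @zeros_min R N [set q | ~ P q]; first by exists p.
by apply: nPq; apply: step => r rq nqr; apply: contrapT => /qmin/(_ rq).
Qed.

(** Over the reals one equation suffices. *)
Lemma zerosI p q : zeros p `&` zeros q = zeros (p ^+ 2 + q ^+ 2).
Proof.
apply/seteqP; split=> x; rewrite /zeros /= !pevalE.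
  by move=> [-> ->]; rewrite expr0n addr0.
by move=> /eqP; rewrite paddr_eq0 ?sqr_ge0// !sqrf_eq0 => /andP[/eqP-> /eqP->].
Qed.

Lemma zerosU p q : zeros p `|` zeros q = zeros (p * q).
Proof.
apply/seteqP; split=> x; rewrite /zeros /= !pevalE.
  by move=> [->|->]; rewrite ?mul0r ?mulr0.
by move=> /eqP; rewrite mulf_eq0 => /orP[/eqP->|/eqP->]; [left|right].
Qed.

Lemma zeros_sqr p : zeros (p ^+ 2) = zeros p.
Proof.
apply/seteqP; split=> x; rewrite /zeros /= !pevalE; last by move=> ->; rewrite expr0n.
by move=> /eqP; rewrite sqrf_eq0 => /eqP.
Qed.

Lemma zariski_closedP A : zariski_closed A <-> exists p, A = zeros p.
Proof.
split=> [[s ->]|[p ->]]; last first.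
  exists [:: p]; apply/seteqP; split=> x /= px; last by apply: px; rewrite inE.
  by move=> q; rewrite inE => /eqP ->.
elim: s => [|p s [q IH]].
  by exists 0; apply/seteqP; split=> x //= _; rewrite /zeros /= peval0.
exists (p ^+ 2 + q ^+ 2); rewrite -zerosI -IH; apply/seteqP; split=> x /=.
  by move=> H; split=> [|r rs]; apply: H; rewrite inE ?eqxx ?rs ?orbT.
by move=> [px sx] r; rewrite inE => /predU1P[->|/sx].
Qed.

Lemma zariski_openP A : zariski_open A <-> exists p, A = ~` zeros p.
Proof.
rewrite /zariski_open zariski_closedP; split=> -[p E]; exists p.
  by rewrite -E setCK.
by rewrite E setCK.
Qed.

Definition quotient_on Y h (p q : pol) :=
  forall y, Y y -> peval q y != 0 /\ h y = peval p y / peval q y.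

Lemma quotient_regular Y h p q : quotient_on Y h p q -> regular_on Y h.
Proof.
move=> H x Yx; exists p, q, setT; split=> //; last by move=> y /H.
  apply/zariski_openP; exists 1; apply/seteqP; split=> y //= _.
    by rewrite /zeros /= peval1; apply/eqP/oner_neq0.
by have [] := H x Yx.
Qed.

(** Fractions with q h = p on Y form a module over the polynomials, and weighting
    two of them by their denominators gives the denominator q^2 + q'^2. So one
    with the smallest zero set of q has no zero of q on Y: a local fraction
    there, multiplied by an equation v of the complement of its domain to make
    it valid on all of Y, would shrink the zero set. *)
Lemma regular_quotient Y h : regular_on Y h -> exists p q, quotient_on Y h p q.
Proof.
move=> reg.
pose S : set pol := [set q | exists p, forall y, Y y -> peval q y * h y = peval p y].
have [|q [p pq] qmin] := @zeros_min R N S.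
  by exists 0, 0 => y _; rewrite !peval0 mul0r.
suff q0 y : Y y -> peval q y != 0.
  exists p, q => y Yy; split; first exact: q0.
  by rewrite -(pq y Yy) mulrAC divff ?mul1r// q0.
move=> Yx; apply/eqP => qx.
have [p1 [q1 [D [/zariski_openP[v ->] Dx q1x H]]]] := reg y Yx.
have vx : peval v y != 0 by apply/eqP.
have : S (q ^+ 2 + (q1 * v) ^+ 2).
  exists (q * p + (q1 * v) * (p1 * v)) => t Yt; rewrite !pevalE mulrDl.
  congr (_ + _); first by rewrite expr2 -mulrA (pq t Yt).
  have [vt|/eqP vt] := eqVneq (peval v t) 0; first by rewrite vt !mulr0 expr0n mul0r.
  by have [q1t ->] := H t Yt vt; field.
rewrite -/(S _) => /qmin; rewrite -zerosI => /(_ (@subIsetl _ _ _) y qx) [_].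
rewrite /zeros /= pevalM; apply/eqP; exact: mulf_neq0.
Qed.

Lemma regular_sub A Y h : A `<=` Y -> regular_on Y h -> regular_on A h.
Proof.
move=> AY reg x Ax; have [p [q [D [Oo Ox qx H]]]] := reg x (AY x Ax).
by exists p, q, D; split=> // y /AY Yy; exact: H.
Qed.

Lemma regular_eq Y f g : (forall x, Y x -> f x = g x) -> regular_on Y f -> regular_on Y g.
Proof.
move=> fg reg x Yx; have [p [q [D [Oo Ox qx H]]]] := reg x Yx.
by exists p, q, D; split=> // y Yy Dy; rewrite -fg//; exact: H.
Qed.

Lemma regularD Y f g : regular_on Y f -> regular_on Y g ->
  regular_on Y (fun y => f y + g y).
Proof.
move=> /regular_quotient[p1 [q1 H1]] /regular_quotient[p2 [q2 H2]].
apply: (@quotient_regular _ _ (p1 * q2 + p2 * q1) (q1 * q2)) => y Yy.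
have [q10 E1] := H1 y Yy; have [q20 E2] := H2 y Yy.
rewrite !pevalE mulf_neq0//= E1 E2; split=> //; field; by rewrite q10 q20.
Qed.

Lemma regularN Y f : regular_on Y f -> regular_on Y (fun y => - f y).
Proof.
move=> /regular_quotient[p [q H]]; apply: (@quotient_regular _ _ (- p) q) => y Yy.
by have [q0 E] := H y Yy; rewrite pevalE E mulNr.
Qed.

(** Take a minimal closed set c that contains a nonempty open subset of W. If this
    subset were covered by two proper closed subsets, the complement of one
    would be a nonempty open subset contained in a smaller closed set. *)
Lemma irreducible_open_exists W : W !=set0 ->
  exists2 v, irreducible (W `\` zeros v) & W `\` zeros v !=set0.
Proof.
move=> [x0 Wx0].
pose S : set pol := [set c | exists v,
  W `\` zeros v !=set0 /\ W `\` zeros v `<=` zeros c].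
have [|c [v [W0 Wc]] cmin] := @zeros_min R N S.
  exists 0, 1; split; last by move=> y _; rewrite /zeros /= peval0.
  by exists x0; split=> //; rewrite /zeros /= peval1; apply/eqP/oner_neq0.
exists v => //; split=> // Z1 Z2 [C1 /zariski_closedP[c1 ->] Z1E]
  [C2 /zariski_closedP[c2 ->] Z2E] E.
have [c1V|nc1V] := pselect (W `\` zeros v `<=` zeros c1).
  by left; rewrite Z1E; apply/esym/setIidl.
right; rewrite Z2E; apply/esym/setIidl.
have : S (c ^+ 2 + c2 ^+ 2).
  exists (v * c1); rewrite -zerosU -zerosI; split.
    apply: contrapT => none; apply: nc1V => y [Wy vy]; apply: contrapT => c1y.
    by apply: none; exists y; split=> // -[].
  move=> y [Wy vc1]; have Vy : (W `\` zeros v) y.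
    by split=> // vy; apply: vc1; left.
  split; first exact: Wc.
  have : (Z1 `|` Z2) y by rewrite -E.
  by rewrite Z1E Z2E => -[[_ c1y]|[]//]; case: vc1; right.
move=> /cmin; rewrite -zerosI => /(_ (@subIsetl _ _ _)) H y /Wc /H [].
by [].
Qed.

Lemma dense_nonempty A Y : zariski_dense Y A -> Y !=set0 -> A !=set0.
Proof.
move=> dense [y Yy]; apply: contrapT => A0.
have /(_ _ Yy (zeros 1)) := dense; rewrite /zariski_closure /bigcap /=.
have -> : zeros 1 = set0 :> set pt.
  by apply/seteqP; split=> x //=; rewrite /zeros /= peval1; apply/eqP/oner_neq0.
apply; split; last by move=> x Ax; apply: A0; exists x.
apply/zariski_closedP; exists 1.
by apply/seteqP; split=> x //=; rewrite /zeros /= peval1 => /eqP; rewrite oner_eq0.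
Qed.

(** Hereditary rationality is only needed on one irreducible V that is open in W: the
    dense open part of V on which f is regular is then open in W as well. *)
Lemma regular_locus c u f : let W := ~` zeros u `&` zeros c in
  hereditarily_rational W f -> W !=set0 ->
  exists v, W `\` zeros v !=set0 /\ regular_on (W `\` zeros v) f.
Proof.
move=> W her W0; have [v irr V0] := irreducible_open_exists W0.
have [| |A [[D /zariski_openP[d ->] AE] dense reg]] := her (W `\` zeros v) _ _ irr.
- exists (zeros c), (~` zeros (u * v)); split.
  + by apply/zariski_closedP; exists c.
  + by apply/zariski_openP; exists (u * v).
  + by rewrite -zerosU setCU setDE /W [_ `&` zeros c]setIC -setIA.
- by move=> x [].
exists (v * d); rewrite -zerosU setDUr.
have -> : (W `\` zeros v) `&` (W `\` zeros d) = A.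
  by rewrite AE; apply/seteqP; split=> x [[Wx vx]]; [move=> [_ dx]|move=> dx].
by split=> //; exact: dense_nonempty dense V0.
Qed.

End Geometry.

(** * The extension theorem *)

Section Extension.
Context {R : realType} {N : nat}.
Local Notation pt := 'rV[R]_N.
Local Notation pol := (mpoly.mpoly N R).
Implicit Types (p q c z u : pol) (x : pt) (f g : pt -> R) (A U V W X Z : set pt).

Lemma hereditarily_rational_sub A Z f :
  A `<=` Z -> hereditarily_rational Z f -> hereditarily_rational A f.
Proof. by move=> AZ her V vV VA; apply: her => // x /VA/AZ. Qed.

Lemma continuous_within U A (F : pt -> R) : A `<=` U ->
  (forall x, U x -> {for x, continuous F}) -> {within A, continuous F}.
Proof.
move=> AU FU; apply/subspace_continuousP => x Ax.
exact: cvg_trans (cvg_app _ (cvg_within _)) (FU x (AU x Ax)).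
Qed.

Lemma zariski_open_open u : open (~` zeros u : set pt).
Proof.
apply: closed_openC; rewrite (_ : zeros u = peval u @^-1` [set 0])//.
by apply: closed_comp; [move=> x _; exact: peval_continuous|exact: closed_eq].
Qed.

(** Noetherian induction on W = U & zeros c: the function F1 extends f from W and
    is regular off W, and the correction f - F1 vanishes on W. *)
Lemma extension_open u c z f : let U := ~` zeros u in
  U `&` zeros c `<=` zeros z ->
  {within U `&` zeros z, continuous f} ->
  hereditarily_rational (U `&` zeros z) f ->
  regular_on ((U `&` zeros z) `\` zeros c) f ->
  exists F : pt -> R, [/\ forall x, U x -> zeros z x -> F x = f x,
    forall x, U x -> {for x, continuous F} & regular_on (U `\` zeros c) F].
Proof.
move=> U; have Uo : open U := @zariski_open_open u.
move: c z f; apply: zeros_induction => c IH z f cz fc her reg.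
have [F1 [F1E F1c F1r]] : exists F1 : pt -> R,
    [/\ forall x, U x -> zeros c x -> F1 x = f x,
        forall x, U x -> {for x, continuous F1} & regular_on (U `\` zeros c) F1].
  have [W0|/set0P W0] := eqVneq (U `&` zeros c) set0.
    exists (fun=> 0); split=> [x Ux cx|x _|].
    - by have : (U `&` zeros c) x by []; rewrite W0.
    - exact: cst_continuous.
    - apply: (@quotient_regular _ _ _ _ 0 1) => y _.
      by rewrite peval0 peval1 mul0r oner_neq0.
  have WZ : U `&` zeros c `<=` U `&` zeros z by move=> x Wx; split; [case: Wx|exact: cz].
  have herW := hereditarily_rational_sub WZ her.
  have [v [[y [[Uy cy] vy]] vreg]] := regular_locus herW W0.
  have cv : zeros (c ^+ 2 + v ^+ 2) = zeros c `&` zeros v by rewrite zerosI.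
  have [| | | | | |F1 [F1E F1c F1r]] := IH (c ^+ 2 + v ^+ 2) _ _ c f.
  - by rewrite cv; exact: subIsetl.
  - by rewrite cv => /(_ y cy) [].
  - by rewrite cv => x [_ []].
  - exact: continuous_subspaceW WZ fc.
  - by [].
  - by apply: regular_sub vreg => x [[Ux cx]]; rewrite cv => nv; split=> // vx; apply: nv.
  exists F1; split=> //; apply: regular_sub F1r => x [Ux ncx].
  by rewrite cv; split=> // -[].
pose g x := f x - F1 x.
have gc : {within U `&` zeros z, continuous g}.
  move=> x; apply: (@continuousB _ _ (subspace (U `&` zeros z)) f F1 x); first exact: fc.
  have := @continuous_within U (U `&` zeros z) F1 (@subIsetl _ _ _) F1c.
  exact.
have greg : regular_on ((U `&` zeros z) `\` zeros c) g.
  apply: regularD => //; apply: regularN; apply: regular_sub F1r.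
  by move=> x [[Ux _] ncx].
have [P [Q PQ]] := regular_quotient greg.
have sq0 (p : pol) x : 0 <= peval (p ^+ 2) x by rewrite pevalX sqr_ge0.
have sqE (p : pol) x : (peval (p ^+ 2) x = 0) <-> zeros p x.
  by rewrite -zeros_sqr.
have [|||p [q [pqE pqc q0]]] :=
    @flat_extension R N U (z ^+ 2) (c ^+ 2) P Q g Uo (sq0 z) (sq0 c).
- by rewrite zeros_sqr.
- move=> x Ux /sqE cx; split; first by apply/sqE; exact: cz.
  by rewrite /g F1E// subrr.
- move=> x Ux /sqE zx /eqP cx; apply: PQ; split=> //.
  by move=> /sqE.
exists (fun x => F1 x + peval p x / peval q x); split=> [x Ux zx|x Ux|].
- by rewrite pqE ?sqE// /g addrC subrK.
- by apply: (@continuousD _ _ _ F1); [exact: F1c|exact: pqc].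
- apply: regularD => //; apply: (@quotient_regular _ _ _ _ p q) => x [Ux ncx].
  by split=> //; apply: q0 => //; apply/eqP => /sqE.
Qed.

(** An irreducible V not contained in zeros c has V \ zeros c as a dense open
    subset, on which F is regular; one that is contained in zeros c lies in Z,
    where F is f. *)
Lemma hereditarily_rational_extension X Z c f F :
  (forall x, Z x -> F x = f x) -> X `&` zeros c `<=` Z ->
  hereditarily_rational Z f -> regular_on (X `\` zeros c) F ->
  hereditarily_rational X F.
Proof.
move=> FE WZ her reg V vV VX irr.
have [VW|nVW] := pselect (V `<=` zeros c).
  have VZ : V `<=` Z by move=> x Vx; apply: WZ; split; [exact: VX|exact: VW].
  have [V0 [oV0 dV0 rV0]] := her V vV VZ irr.
  exists V0; split=> //; apply: regular_eq rV0 => x V0x; rewrite FE//; apply: VZ.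
  by case: oV0 V0x => O _ -> [].
exists (V `\` zeros c); split; last by apply: regular_sub reg => x [/VX].
  by exists (~` zeros c) => //; apply/zariski_openP; exists c.
move=> x Vx D [Dcl VD].
have [_ /(_ (V `&` zeros c) (V `&` D))] := irr.
have cl p : zariski_closed (zeros p) by apply/zariski_closedP; exists p.
case.
- by exists (zeros c).
- by exists D.
- apply/seteqP; split=> [y Vy|y [[]|[]]//].
  by have [cy|ncy] := pselect (zeros c y); [left|right; split=> //; apply: VD].
- by move=> VE; case: nVW; rewrite VE => y [].
- by move=> VE; move: Vx; rewrite VE => -[].
Qed.

End Extension.

Theorem proposition10 (R : realType) (N : nat) (X Z W : set 'rV[R]_N)
    (hX : variety X) (sX : smooth X)
    (hZ : closed_subvariety X Z) (hW : closed_subvariety X W) (hWZ : W `<=` Z)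
    (f : 'rV[R]_N -> R)
    (fcont : {within Z, continuous f})
    (fher : hereditarily_rational Z f)
    (freg : regular_on (Z `\` W) f) :
  exists F : 'rV[R]_N -> R,
    [/\ forall x, Z x -> F x = f x,
        {within X, continuous F},
        hereditarily_rational X F
      & regular_on (X `\` W) F].
Proof.
case: hX => C [U [/zariski_closedP[c ->] /zariski_openP[u ->] XE]].
case: hZ => Z' /zariski_closedP[z ->] ZE; case: hW => W' /zariski_closedP[w ->] WE.
have XI p : X `&` zeros p = ~` zeros u `&` zeros (c ^+ 2 + p ^+ 2).
  by rewrite XE -zerosI setIA [_ `&` zeros c]setIC.
have WI : X `\` zeros (c ^+ 2 + w ^+ 2) = X `\` W.
  rewrite -zerosI WE XE; apply/seteqP; split=> x [[cx ux] nw].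
    by split=> // -[_ wx]; apply: nw.
  by split=> // -[_ wx]; apply: nw.
have ZX : Z `<=` X by rewrite ZE; exact: subIsetl.
have [||||F [FE Fc Fr]] := @extension_open R N u (c ^+ 2 + w ^+ 2) (c ^+ 2 + z ^+ 2) f.
- by rewrite -!XI -WE => x /hWZ; rewrite ZE -zerosI XE => -[[]].
- by rewrite -XI -ZE.
- by rewrite -XI -ZE.
- rewrite -XI -ZE; apply: regular_sub freg => x [Zx nw]; split=> // Wx; apply: nw.
  by move: Wx; rewrite WE XI => -[].
have XU : X `<=` ~` zeros u by rewrite XE => x [].
have FZ x : Z x -> F x = f x.
  by rewrite ZE XI => -[ux zx]; exact: FE.
have FX : regular_on (X `\` W) F.
  by rewrite -WI; apply: regular_sub Fr => x [/XU].
exists F; split=> //; first exact: continuous_within XU Fc.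
apply: (@hereditarily_rational_extension _ _ _ Z (c ^+ 2 + w ^+ 2) f) => //.
  move=> x [Xx]; rewrite -zerosI => -[_ wx]; apply: hWZ; rewrite WE; by [].
by rewrite WI.
Qed.
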